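(* Let $G=(V,E)$ be a graph with maximum degree at most $\Delta$ that is equipped with a proper input vertex coloring with $m$ colors. Let $d$ and $k$ be integers with $0\leq d\leq \Delta-1$ and $1\leq k\leq X$, where $$X=4\cdot\frac{\Delta}{d+1}\cdot\Big\lceil\log_{\Delta/(d+1)}m\Big\rceil,$$ and suppose $m,\Delta,d,k$ are known to all vertices. Then there is a deterministic \textsf{CONGEST} algorithm that uses $R=\lceil X/k\rceil$ rounds and computes a vertex coloring with $C=X\cdot k$ colors such that (1) the subgraph of $G$ induced by each color class admits an orientation of its edges in which every vertex has outdegree at most $d$; (2) each color class can be partitioned into $R$ sets $P_1,\ldots,P_R$ such that the subgraph of $G$ induced by each $P_i$ has maximum degree at most $d$. Moreover, the orientation in (1) and the partition in (2) are computed by the algorithm within the same $R$ rounds (no additional rounds).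
   Context: The \textsf{CONGEST} model: the graph $G=(V,E)$ is the communication network; computation proceeds in synchronous rounds, in each of which every vertex can send one message of $O(\log n)$ bits to each of its neighbors ($n=|V|$), and local computation is free. Initially each vertex knows only its own color in the input coloring (and the stated global parameters); at the end each vertex must know its own output color (and, here, the orientation of its incident edges and the index of its part). A (proper) $m$-coloring is a map $V\to\{0,\ldots,m-1\}$ assigning different colors to adjacent vertices. The output coloring here is not required to be proper; its properties are exactly those listed in (1) and (2).
   Formalization: Messages have O(log max(n,m)) bits instead of O(log n), since with O(log n) bits the claim fails when m is unbounded in n; for m polynomial in n the two agree. The case d = Δ−1, where the logarithm in X has base 1 and is undefined, is vacuous. *)

(* Defs.v *)
From HB Require Import structures.
From mathcomp Require Import all_boot all_order all_algebra.
From mathcomp Require Import reals exp.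

Set Implicit Arguments.
Unset Strict Implicit.
Unset Printing Implicit Defensive.

Import Order.TTheory GRing.Theory Num.Theory.

(** * Graphs *)

Section Graphs.
Variables (V : finType) (e : rel V).

Definition simple_graph := symmetric e /\ irreflexive e.

(** Maximum degree of the subgraph induced by [A]. *)
Definition max_degree (A : {set V}) : nat :=
  \max_(v in A) #|[set u in A | e v u]|.

Definition proper_coloring (C : eqType) (c : V -> C) : Prop :=
  forall u v, e u v -> c u != c v.

Definition color_class (C : eqType) (c : V -> C) (x : C) : {set V} :=
  [set v | c v == x].

(** [a u v] reads "the edge [uv] is directed from [u] to [v]"; only the edges
    of the subgraph induced by [A] are concerned. *)
Definition orients (A : {set V}) (a : rel V) : Prop :=
  {in A &, forall u v, e u v -> a u v = ~~ a v u}.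

Definition max_outdegree (A : {set V}) (a : rel V) : nat :=
  \max_(v in A) #|[set u in A | e v u && a v u]|.

(** A port numbering: [port v] lists the neighbors of [v] in some order, and
    the [i]-th port of [v] is its link to the [i]-th neighbor in that list. *)
Definition port_numbering (port : V -> seq V) : Prop :=
  forall v, uniq (port v) /\ port v =i e v.

End Graphs.

(** * Deterministic synchronous message passing *)

(** All vertices run the same algorithm; they have no identifiers and tell
    their neighbors apart by port only. The initial state depends on the input
    value alone, so that even the degree has to be learnt from the list of
    received messages. Local computation is unrestricted. *)
Record algorithm (I O : Type) := Algorithm {
  state : Type;
  init : I -> state;
  send : state -> nat -> seq bool;
  receive : state -> seq (seq bool) -> state;
  output : state -> O
}.

Section Execution.
Variables (I O : Type) (A : algorithm I O).
Variables (V : finType) (port : V -> seq V) (input : V -> I).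

Definition message (s : V -> state A) (u v : V) : seq bool :=
  send (s u) (index v (port u)).

Definition round (s : V -> state A) : V -> state A :=
  fun v => receive (s v) [seq message s u v | u <- port v].

(** Global state after [t] rounds. *)
Definition run (t : nat) : V -> state A :=
  iter t round (fun v => init A (input v)).

Definition result (t : nat) (v : V) : O := output (run t v).

(** In each of the first [t] rounds, every message has at most [b] bits. *)
Definition bandwidth_le (e : rel V) (t b : nat) : Prop :=
  forall i u v, i < t -> e u v -> size (message (run i) u v) <= b.

End Execution.

(** * Rounds, colors and outputs *)

Section Quantities.
Local Open Scope ring_scope.
Variables (R : realType) (m Delta d k : nat).

(** [Delta = d + 1] would be a logarithm in base 1: there [ln 1 = 0] and
    division by zero make [param_X] equal to [0], so that no [k] satisfies
    [1 <= k <= param_X]. *)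
Definition param_X : R :=
  4 * (Delta%:R / d.+1%:R) *
  (Num.ceil (ln (m%:R : R) / ln (Delta%:R / d.+1%:R)))%:~R.

Definition num_rounds : nat := `|Num.ceil (param_X / k%:R)|%N.

(** [param_X] need not be an integer; an integer number of colors is at most
    [param_X * k] iff it is at most the integer part. *)
Definition num_colors : nat := Num.truncn (param_X * k%:R).

End Quantities.

(** What a vertex outputs. [vo_out i] tells whether the edge at port [i] is
    directed away from the vertex; the two endpoints decide separately, and
    their answers have to agree on edges inside a color class. *)
Record vertex_output (C P : nat) := VertexOutput {
  vo_color : 'I_C;
  vo_part : 'I_P;
  vo_out : nat -> bool
}.

Definition arc_of (V : finType) (port : V -> seq V) (C P : nat)
    (out : V -> vertex_output C P) : rel V :=
  fun u v => vo_out (out u) (index v (port u)).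

(* Main.v *)
(** Let [q] be a power of two with [X / 2 < q <= X], and give every input color
    a polynomial over the field with [q] elements, of degree at most
    [f = ceil (log_(Delta/(d+1)) m)], such that distinct polynomials agree in at
    most [f] points and every polynomial takes each value at most [f] times.
    A vertex with polynomial [p] makes trials [x = 0, 1, ..., q - 1], in batches
    of [k] per round, trial [x] being the attempt to adopt the color
    [(x mod k, p x)]; it adopts the first one which conflicts with at most [d]
    neighbors, counting both those making the same trial and those having
    adopted this color before. Every neighbor spoils at most [2 f] trials, and
    [2 f Delta < (d + 1) q], so some trial succeeds. Edges inside a color class
    point to conflicting neighbors, and the rounds of adoption are the parts. *)

Require Import Defs.
From HB Require Import structures.
From mathcomp Require Import all_boot all_order all_algebra all_field.
From mathcomp Require Import reals exp ring.
Set Implicit Arguments.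
Unset Strict Implicit.
Unset Printing Implicit Defensive.
Import Order.TTheory GRing.Theory Num.Theory.

(** * Fixed-length binary codes *)

Lemma bit_encoding (T : finType) (w : nat) :
  #|T| <= 2 ^ w ->
  exists (enc : T -> seq bool) (dec : seq bool -> option T),
    pcancel enc dec /\ forall x, size (enc x) = w.
Proof.
move=> leT; have le2 : #|T| <= #|{: w.-tuple bool}|
  by rewrite card_tuple card_bool.
pose enc (x : T) := tval (enum_val (widen_ord le2 (enum_rank x))).
exists enc, (fun s => [pick x | enc x == s]); split => x; last exact: size_tuple.
case: pickP => [y|/(_ x)]; last by rewrite eqxx.
move=> /eqP/val_inj/enum_val_inj/(congr1 val) /= eq_yx.
by congr Some; apply: enum_rank_inj; apply: val_inj.
Qed.

(** * Polynomials with few agreements over a finite field *)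

Section PolynomialFamily.
Local Open Scope ring_scope.
Variable F : finFieldType.

Lemma card_roots_le (p : {poly F}) (f : nat) :
  p != 0 -> (size p <= f.+1)%N -> (#|[set x | root p x]| <= f)%N.
Proof.
move=> p0 szp; rewrite cardE -ltnS; apply: leq_trans szp.
apply: max_poly_roots => //; last exact: enum_uniq.
by apply/allP => x; rewrite mem_enum inE.
Qed.

(* Nonzero multiples of ['X] are non-constant, hence take each value rarely; the
   neighbors which have already adopted a color call for this second bound. *)
Lemma few_collisions_field (m f : nat) :
  (m < #|F| ^ f)%N ->
  exists h : 'I_m -> 'I_#|F| -> 'I_#|F|,
    (forall i j, i != j -> #|[set x | h i x == h j x]| <= f)%N /\
    (forall i b, #|[set x | h i x == b]| <= f)%N.
Proof.
move=> lt_m.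
(* Coefficient vectors; the strict bound on [m] makes up for leaving out zero. *)
pose S := [set v : 'rV[F]_f | v != 0].
have leS : (m <= #|S|)%N.
  rewrite -ltnS; apply: leq_trans lt_m _.
  have := card_mx F 1 f; rewrite mul1n => <-.
  by rewrite -cardsT (cardsD1 0 setT) inE add1n ltnS subset_leq_card //;
     apply/subsetP => v; rewrite !inE andbT.
pose g (i : 'I_m) : 'rV[F]_f := enum_val (widen_ord leS i).
have g_inj : injective g by move=> i j /enum_val_inj/(congr1 val)/= /val_inj.
have g0 i : g i != 0 by have := enum_valP (widen_ord leS i); rewrite inE.
pose P i : {poly F} := 'X * rVpoly (g i).
have szP i : (size (P i) <= f.+1)%N.
  by rewrite /P mulrC; apply: leq_trans (size_polyMleq _ _) _; rewrite size_polyX addn2 ltnS size_poly.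
have nzX : 'X != 0 :> {poly F} by rewrite polyX_eq0.
have transfer (a : {poly F}) (A : {set 'I_#|F|}) :
    a != 0 -> (size a <= f.+1)%N -> {subset A <= [pred x | root a (enum_val x)]} ->
    (#|A| <= f)%N.
  move=> a0 sza sub; apply: leq_trans (card_roots_le a0 sza).
  rewrite -(card_imset A (@enum_val_inj _ F)); apply/subset_leq_card/subsetP.
  by move=> _ /imsetP[x /sub xA ->]; rewrite inE.
exists (fun i x => enum_rank (P i).[enum_val x]); split.
  move=> i j ij; apply: (transfer (P i - P j)).
  - rewrite subr_eq0; apply: contra ij => /eqP/(mulfI nzX)/(can_inj rVpolyK)/g_inj ->.
    exact: eqxx.
  - by apply: leq_trans (size_polyD _ _) _; rewrite geq_max size_polyN !szP.
  - by move=> x; rewrite !inE => /eqP/enum_rank_inj eqx; rewrite rootE hornerD hornerN eqx subrr.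
move=> i b; apply: (transfer (P i - (enum_val b)%:P)).
(* Comparing constant coefficients, a constant multiple of ['X] is zero, which would force
   [g i = 0]. *)
- apply: contra (g0 i); rewrite subr_eq0 => /eqP Pb.
  have := congr1 (fun p : {poly F} => p`_0) Pb.
  rewrite /P coefXM coefC /= => b0; move/eqP: Pb; rewrite -b0 polyC0 mulf_eq0 (negPf nzX) /=.
  by move=> /eqP r0; rewrite -(rVpolyK (g i)) r0 raddf0.
- apply: leq_trans (size_polyD _ _) _; rewrite geq_max size_polyN szP.
  by apply: leq_trans (size_polyC_leq1 _) _.
- move=> x; rewrite !inE => /eqP <-.
  by rewrite rootE hornerD hornerN hornerC enum_rankK subrr.
Qed.

End PolynomialFamily.

Lemma few_collisions (m s f : nat) :
  0 < s -> m < (2 ^ s) ^ f ->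
  exists h : 'I_m -> 'I_(2 ^ s) -> 'I_(2 ^ s),
    (forall i j, i != j -> #|[set x | h i x == h j x]| <= f) /\
    (forall i b, #|[set x | h i x == b]| <= f).
Proof.
move=> s0; have [F _ <-] := pPrimePowerField (isT : prime 2) s0.
exact: few_collisions_field.
Qed.

(** * Choice of the field size *)

(** After [0 < s], the bounds guarantee in turn: an unspoilt trial, a polynomial for each input
    color, room for the colors, and time for all trials. *)
Lemma field_size (R : realType) (m Delta d k : nat) :
  d < Delta -> 1 <= k -> (k%:R <= param_X R m Delta d)%R ->
  exists s f : nat,
    [/\ 0 < s, 2 * f * Delta < d.+1 * 2 ^ s, m < (2 ^ s) ^ f,
        k * 2 ^ s <= num_colors R m Delta d k
      & 2 ^ s <= k * num_rounds R m Delta d k].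
Proof.
move=> lt_d k_gt0 le_kX; rewrite /num_colors /num_rounds.
move: le_kX; rewrite /param_X; set b : R := (_ / d.+1%:R)%R.
set z := Num.ceil _; set X : R := (4 * b * _)%R => le_kX.
have k_pos : (0 < k%:R :> R)%R by rewrite ltr0n.
have X_gt0 : (0 < X)%R by exact: lt_le_trans k_pos le_kX.
have d_pos : (0 < d.+1%:R :> R)%R by rewrite ltr0n.
have b_ge1 : (1 <= b)%R by rewrite ler_pdivlMr // mul1r ler_nat.
have b_gt0 : (0 < b)%R by exact: lt_le_trans ltr01 b_ge1.
have z_gt0 : (0 < z)%R.
  by move: X_gt0; rewrite /X pmulr_rgt0 ?ltr0z //; apply: mulr_gt0.
pose f := `|z|%N.
have zE : (z%:~R = f%:R :> R)%R by rewrite /f natr_absz gtr0_norm.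
have f_gt0 : (1 <= f)%N by rewrite /f absz_gt0 gt_eqF.
have f_ge1 : (1 <= f%:R :> R)%R by rewrite ler1n.
have quot_gt0 : (0 < ln (m%:R : R) / ln b)%R by rewrite -ceil_gt0.
(* For [b = 1] the quotient is a division by zero, hence [0], against [quot_gt0]. *)
have lnb_gt0 : (0 < ln b)%R.
  rewrite lt_neqAle ln_ge0 // andbT eq_sym; apply: contraTneq quot_gt0 => ->.
  by rewrite invr0 mulr0 ltxx.
have m_gt0 : (0 < m%:R :> R)%R.
  rewrite ltNge; apply: contraTN quot_gt0 => /ln0 ->; by rewrite mul0r ltxx.
have m_le : (m%:R <= b ^+ f)%R.
  rewrite -ler_ln ?posrE ?exprn_gt0 // lnXn // -[leRHS]mulr_natl -zE -ler_pdivrMr //.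
  exact: ceil_ge.
have XE : X = (4 * b * f%:R)%R by rewrite /X zE.
have X_ge4 : (4 <= X)%R.
  by rewrite XE -mulrA; apply: ler_peMr; rewrite ?ler0n // mulr_ege1.
have X2E : X = (2 * (2 * b * f%:R))%R by rewrite XE; ring.
have b_le : (b <= 2 * b * f%:R)%R.
  by rewrite mulrAC ler_peMl ?(ltW b_gt0) // mulr_ege1 ?ler1n.
have b_fE : (d.+1%:R^-1 * (2 * f%:R * Delta%:R) = 2 * b * f%:R)%R.
  by rewrite /b; ring.
pose n := Num.truncn X; pose s := trunc_log 2 n.
have n_gt3 : 4 <= n by rewrite /n truncn_ge_nat // ltW.
have leq_qn : 2 ^ s <= n by apply: trunc_logP => //; apply: leq_trans n_gt3.
have ltn_n2q : n < 2 ^ s.+1 by apply: trunc_log_ltn.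
have le_qX : ((2 ^ s)%:R <= X)%R by rewrite -truncn_ge_nat // ltW.
have lt_X2q : (X < 2 * (2 ^ s)%:R)%R.
  by rewrite -natrM -expnS -truncn_lt_nat // ltW.
have s_gt0 : 0 < s by rewrite /s trunc_log_gt0 /=; apply: leq_trans n_gt3.
(* Of the factor 4 in [X], one 2 pays for rounding down to a power of two; the other remains for the
   two kinds of spoilt trials. *)
have lt_bq : (2 * b * f%:R < (2 ^ s)%:R)%R.
  by rewrite -(ltr_pM2l (ltr0Sn R 1)) -X2E.
exists s, f; split => //.
- by rewrite -(ltr_nat R) !natrM -ltr_pdivrMl // b_fE.
(* Strict because [b <= 2 * b * f < 2 ^ s] and [f > 0]. *)
- rewrite -(ltr_nat R) natrX; apply: le_lt_trans m_le _.
  by rewrite ltrXn2r ?ltW ?(le_lt_trans b_le) // -lt0n.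
- rewrite truncn_ge_nat; last by rewrite mulr_ge0 // ltW.
  by rewrite natrM mulrC ler_wpM2r // ltW.
- rewrite -(ler_nat R) natrM; apply: le_trans le_qX _.
  have := ceil_ge (X / k%:R); rewrite ler_pdivrMr // mulrC => /le_trans; apply.
  by rewrite ler_pM2l // natr_absz ger0_norm // ltW // ceil_gt0 divr_gt0.
Qed.

Lemma leq_max_degree (V : finType) (e : rel V) (A : {set V}) (D : nat) :
  reflect (forall v, v \in A -> #|[set u in A | e v u]| <= D)
          (max_degree e A <= D).
Proof. exact: bigmax_leqP. Qed.

Lemma leq_max_outdegree (V : finType) (e a : rel V) (A : {set V}) (D : nat) :
  reflect (forall v, v \in A -> #|[set u in A | e v u && a v u]| <= D)
          (max_outdegree e A a <= D).
Proof. exact: bigmax_leqP. Qed.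

(** * The trial algorithm *)

Section TrialAlgorithm.
Variables (m q k d C P : nat) (h : 'I_m -> 'I_q -> 'I_q).

(* What a vertex announces: its input color, and its trial once adopted. *)
Definition info : Type := 'I_m * option 'I_q.

(* Trial [x] of a vertex with input color [i] stands for the output color
   [(x %% k, h i x)]; it is made in round [x %/ k]. *)
Definition conflict (i : 'I_m) (x : 'I_q) (w : info) : bool :=
  if w.2 is Some y then (y %% k == x %% k) && (h w.1 y == h i x)
  else h w.1 x == h i x.

(* An edge points to the endpoint which adopted its trial first, unless the
   endpoints were in conflict at that moment: then the edge has already been
   directed along the input colors, as the first endpoint cannot foresee
   whether the other one adopts the same trial in the same round. *)
Definition arc_to (i : 'I_m) (x : 'I_q) (w : info) : bool :=
  conflict i x w &&
  (if w.2 is Some y then ~~ ((h i y == h w.1 y) && (w.1 < i)) else i < w.1).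

Record trial_state := TrialState {
  st_input : 'I_m;
  st_time : nat;
  st_trial : option 'I_q;
  st_arc : nat -> bool
}.

Variables (enc : info -> seq bool) (dec : seq bool -> option info).
Variables (C0 : 'I_C) (P0 : 'I_P).

Definition st_info (s : trial_state) : info := (st_input s, st_trial s).

Definition next_trial (i : 'I_m) (t : nat) (nbrs : seq info) : option 'I_q :=
  [pick x : 'I_q | (x %/ k == t) && (count (conflict i x) nbrs <= d)].

Definition trial_step (s : trial_state) (msgs : seq (seq bool)) : trial_state :=
  let: TrialState i t x a := s in
  let nbrs := pmap dec msgs in
  if x is Some _ then TrialState i t.+1 x a else
  let x' := next_trial i t nbrs in
  TrialState i t.+1 x'
    (fun j => if x' is Some y then arc_to i y (nth (i, None) nbrs j) else false).

(** The pair [(x %% k, h i x)] is coded as a number below [k * q]; the part is the round of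
    adoption. *)
Definition trial_output (s : trial_state) : vertex_output C P :=
  let: TrialState i _ x a := s in
  if x is Some y then
    VertexOutput (insubd C0 (y %% k * q + h i y)) (insubd P0 (y %/ k)) a
  else VertexOutput C0 P0 a.

Definition trial_algorithm : algorithm 'I_m (vertex_output C P) :=
  @Algorithm _ _ trial_state
    (fun i => TrialState i 0 None (fun=> false))
    (fun s _ => enc (st_info s)) trial_step trial_output.

(** * Correctness of the trial algorithm *)

Section Correctness.
Variables (V : finType) (e : rel V) (port : V -> seq V) (input : V -> 'I_m).
Variables (Delta f : nat).
Hypotheses (encK : pcancel enc dec) (k_gt0 : 0 < k).
Hypotheses (le_kqC : k * q <= C) (le_qkP : q <= k * P).
Hypothesis few_agreements :
  forall i j, i != j -> #|[set x | h i x == h j x]| <= f.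
Hypothesis few_preimages : forall i b, #|[set x | h i x == b]| <= f.
Hypothesis enough_trials : 2 * f * Delta < d.+1 * q.
Hypotheses (e_sym : symmetric e) (e_deg : max_degree e [set: V] <= Delta).
Hypotheses (portP : port_numbering e port) (inputP : proper_coloring e input).

Local Notation run t := (run trial_algorithm port input t).

Let trial (t : nat) (v : V) : option 'I_q := st_trial (run t v).
Let view (t : nat) (v : V) : info := (input v, trial t v).

Lemma run_input_time t v : st_input (run t v) = input v /\ st_time (run t v) = t.
Proof.
elim: t => [//|t]; rewrite /Defs.run iterS -/(run t) /round /= /trial_step.
by case: (run t v) => i t' [x|] a /= [-> ->].
Qed.

Lemma st_info_run t v : st_info (run t v) = view t v.
Proof. by rewrite /st_info (run_input_time t v).1. Qed.

Lemma run_adopted t v x : trial t v = Some x ->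
  trial t.+1 v = Some x /\ st_arc (run t.+1 v) = st_arc (run t v).
Proof.
rewrite /trial /Defs.run iterS -/(run t) /round /= /trial_step.
by case: (run t v) => i t' [y|] a //= ->.
Qed.

Lemma run_searching t v (nbrs := [seq view t u | u <- port v]) :
  trial t v = None ->
  trial t.+1 v = next_trial (input v) t nbrs /\
  forall x j, trial t.+1 v = Some x ->
    st_arc (run t.+1 v) j = arc_to (input v) x (nth (input v, None) nbrs j).
Proof.
have nbrsE : pmap dec [seq message port (run t) u v | u <- port v] = nbrs.
  rewrite /nbrs /message /= (eq_map (g := enc \o view t)); last first.
    by move=> u /=; rewrite st_info_run.
  by rewrite map_comp (map_pK encK).
have [] := run_input_time t v.
rewrite /trial /Defs.run iterS -/(run t) /round /= /trial_step nbrsE.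
by case: (run t v) => i t' x a /= -> -> -> /=; split=> // x' j ->.
Qed.

Lemma trial_mono t t' v x : t <= t' -> trial t v = Some x ->
  trial t' v = Some x /\ st_arc (run t' v) = st_arc (run t v).
Proof.
move=> /subnK <-; elim: (t' - t) => [//|n IHn] /IHn[tx <-].
by rewrite addSn; apply: run_adopted.
Qed.

Lemma count_port (a : pred info) t v :
  count a [seq view t u | u <- port v] = #|[set u | e v u & a (view t u)]|.
Proof.
have [uniq_v mem_v] := portP v.
rewrite count_map -size_filter -(card_uniqP (filter_uniq _ uniq_v)).
apply: eq_card => u; rewrite !inE mem_filter mem_v andbC.
by rewrite -topredE.
Qed.

(** The adopted trial reveals its round [x %/ k], and an adopted state is frozen; so conflicts and
    arcs are those seen in that round. *)
Lemma adoption T v x : trial T v = Some x ->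
  let r := x %/ k in
  [/\ r < T, trial r v = None,
      forall t, r < t -> trial t v = Some x,
      #|[set u | e v u & conflict (input v) x (view r u)]| <= d
    & forall u, e v u -> st_arc (run T v) (index u (port v)) =
                         arc_to (input v) x (view r u)].
Proof.
elim: T => [//|T IHT].
case tT: (trial T v) => [y|].
  have [-> ->] := run_adopted tT; case => eq_yx; rewrite eq_yx in tT.
  by have [rT ? ? ? ?] := IHT tT; split=> //; apply: ltnW.
have [tS arcS] := run_searching tT; move=> tS1.
have: next_trial (input v) T [seq view T u | u <- port v] = Some x by rewrite -tS.
rewrite /next_trial; case: pickP => // y /andP[/eqP y_T cnt] [eq_yx].
rewrite -eq_yx in tS1 arcS *; rewrite y_T /=; split => //.
- by move=> t ltTt; have [] := trial_mono ltTt tS1.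
- by rewrite -count_port.
move=> u vu; rewrite (arcS _ _ tS1) (nth_map u) ?nth_index ?index_mem //;
  by have [_ ->] := portP v.
Qed.

(** Double counting of pairs of a trial and a neighbor spoiling it: without success each of the [q]
    trials has more than [d] such neighbors, while each of at most [Delta] neighbors spoils at most
    [2 * f] trials. *)
Lemma trial_exists v : exists x, trial P v = Some x.
Proof.
case tv: (trial P v) => [x|]; first by exists x.
have none t : t <= P -> trial t v = None.
  move=> le_t; case tt: (trial t v) => [x|//].
  by have [] := trial_mono le_t tt; rewrite tv.
have many (x : 'I_q) : d < #|[set u | e v u & conflict (input v) x (view (x %/ k) u)]|.
  have ltr : x %/ k < P by rewrite ltn_divLR // mulnC (leq_trans _ le_qkP).
  have [tS _] := run_searching (none _ (ltnW ltr)); move: tS; rewrite none //.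
  rewrite /next_trial; case: pickP => // /(_ x); rewrite eqxx /= count_port.
  by move=> /negbT; rewrite -ltnNge.
have few u : e v u -> #|[set x | conflict (input v) x (view (x %/ k) u)]| <= 2 * f.
  move=> vu; pose A := [set x | h (input v) x == h (input u) x].
  (* A neighbor keeps what it adopts, so its final trial [y] accounts for every round after its
     adoption. *)
  pose B := if trial P u is Some y then [set x | h (input v) x == h (input u) y] else set0.
  have leB : #|B| <= f.
    by rewrite /B; case: (trial P u) => [y|]; rewrite ?cards0 ?few_preimages.
  have leA : #|A| <= f by apply/few_agreements/inputP.
  rewrite mul2n -addnn; apply: leq_trans (leq_add leA leB).
  apply: leq_trans (leq_card_setU A B); apply/subset_leq_card/subsetP => x.
  rewrite !inE /conflict /= eq_sym; case tu: (trial (x %/ k) u) => [y|] /=; last first.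
    by rewrite eq_sym => ->.
  have ltr : x %/ k < P by rewrite ltn_divLR // mulnC (leq_trans _ le_qkP).
  have [tuP _] := trial_mono (ltnW ltr) tu.
  by move=> /andP[_]; rewrite eq_sym /B tuP inE => ->; rewrite orbT.
have: d.+1 * q <= 2 * f * Delta; last by rewrite leqNgt enough_trials.
have deg : #|[set u | e v u]| <= Delta.
  have /leq_max_degree/(_ v (in_setT v)) := e_deg.
  by congr (_ <= _); apply: eq_card => u; rewrite !inE.
apply: leq_trans (leq_mul (leqnn _) deg).
rewrite mulnC -{1}[q]card_ord -sum_nat_const -[leqRHS]mulnC -sum_nat_const.
apply: (@leq_trans (\sum_(x : 'I_q) \sum_(u in [set u | e v u])
                      conflict (input v) x (view (x %/ k) u))).
  apply: leq_sum => x _; apply: leq_trans (many x) _.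
  rewrite -sum1dep_card big_mkcondr /=; apply: eq_leq.
  by apply: eq_big => [u|u _]; rewrite ?inE //; case: ifP.
rewrite exchange_big /=; apply: leq_sum => u; rewrite inE => vu.
apply: leq_trans (few u vu); apply: eq_leq.
by rewrite -sum1dep_card [RHS]big_mkcond /=; apply: eq_bigr => x _; case: ifP.
Qed.

Let out := result trial_algorithm port input P.

Lemma outputE v : exists x, trial P v = Some x /\
  [/\ vo_color (out v) = x %% k * q + h (input v) x :> nat,
      vo_part (out v) = x %/ k :> nat
    & vo_out (out v) = st_arc (run P v)].
Proof.
have [x tx] := trial_exists v; exists x; split=> //.
have ltr : x %/ k < P by rewrite ltn_divLR // mulnC (leq_trans _ le_qkP).
have [+ _] := run_input_time P v; move: tx; rewrite /trial /out /result /=.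
case: (run P v) => i t x' a /= -> ->; split => //=; rewrite val_insubd.
- rewrite ifT //; apply: leq_trans le_kqC; apply: (@leq_trans ((x %% k).+1 * q)).
    by rewrite mulSn addnC ltn_add2r.
  by rewrite leq_mul2r ltn_mod k_gt0 orbT.
- by rewrite ltr.
Qed.

(** Division by [q] decodes the pair, since the values of [h] are below [q]. *)
Lemma same_color u v x y :
  trial P u = Some x -> trial P v = Some y -> vo_color (out u) = vo_color (out v) ->
  x %% k = y %% k /\ h (input u) x = h (input v) y.
Proof.
move=> tx ty; have [x' [+ [+ _ _]]] := outputE u; rewrite tx => -[<-] cu.
have [y' [+ [+ _ _]]] := outputE v; rewrite ty => -[<-] cv.
move=> /(congr1 val) /=; rewrite cu cv => eq_c.
have q_gt0 : 0 < q by apply: leq_trans (ltn_ord x).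
split; last by apply: val_inj; move/(congr1 (modn^~ q)): eq_c; rewrite !modnMDl !modn_small.
by move/(congr1 (divn^~ q)): eq_c; rewrite !divnMDl // !divn_small // !addn0.
Qed.

(* The trials made in one round have distinct remainders mod [k]. *)
Lemma conflict_of_same_color v u x y :
  trial P v = Some x -> trial P u = Some y -> vo_color (out v) = vo_color (out u) ->
  y %/ k <= x %/ k -> conflict (input v) x (view (x %/ k) u).
Proof.
move=> tx ty /(same_color tx ty)[eq_mod eq_h] le_r.
have [_ _ trial_u _ _] := adoption ty; rewrite /conflict /=.
case: (ltngtP (y %/ k) (x %/ k)) le_r => // [lt_r|eq_r] _.
  by rewrite trial_u //= eq_mod eq_h !eqxx.
have eq_xy : x = y by apply: val_inj; rewrite /= (divn_eq x k) (divn_eq y k) eq_mod eq_r.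
by have [_ + _ _ _] := adoption ty; rewrite eq_r => ->; rewrite {1}eq_xy -eq_h.
Qed.

Lemma arc_ofE v u x : trial P v = Some x -> e v u ->
  arc_of port out v u = arc_to (input v) x (view (x %/ k) u).
Proof.
move=> tx vu; have [x' [_ [_ _ arcE]]] := outputE v.
by have [_ _ _ _ arc_x] := adoption tx; rewrite /arc_of arcE arc_x.
Qed.

Lemma arc_antisym u v : e u v -> vo_color (out u) = vo_color (out v) ->
  arc_of port out u v = ~~ arc_of port out v u.
Proof.
wlog: u v / exists x y, [/\ trial P u = Some x, trial P v = Some y & x %/ k <= y %/ k].
  move=> W; have [x [tx _]] := outputE u; have [y [ty _]] := outputE v.
  case/orP: (leq_total (x %/ k) (y %/ k)) => le_r uv eq_c.
    by apply: W => //; exists x, y.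
  by rewrite [in RHS]W ?negbK 1?e_sym //; exists y, x.
move=> [x [y [tx ty le_r]]] uv eq_c; have vu : e v u by rewrite e_sym.
rewrite (arc_ofE tx uv) (arc_ofE ty vu) /arc_to.
rewrite (conflict_of_same_color ty tx (esym eq_c) le_r) /=.
have [_ u_searching u_adopted _ _] := adoption tx.
have [_ v_searching v_adopted _ _] := adoption ty.
(* If [u] adopts first, it sees [v] searching and points to it iff their values at [x] agree and
   [input u < input v]; [v] later recomputes this test and negates it. *)
case: (ltngtP (x %/ k) (y %/ k)) le_r => // [lt_r|eq_r] _.
  have v_None : trial (x %/ k) v = None.
    case tv: (trial _ v) => [z|//].
    by have [] := trial_mono (ltnW lt_r) tv; rewrite v_searching.
  by rewrite u_adopted //= negbK /conflict /= v_None.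
(* In a common round both see a searching, conflicting neighbor, and the distinct input colors
   decide. *)
rewrite (conflict_of_same_color tx ty eq_c) ?eq_r // -eq_r u_searching.
rewrite eq_r v_searching /= -leqNgt ltn_neqAle.
by move: (inputP uv); rewrite -val_eqE => ->.
Qed.

Lemma trial_algorithm_correct (b : nat) :
  (forall w, size (enc w) <= b) ->
  [/\ bandwidth_le trial_algorithm port input e P b,
      forall x, orients e (color_class (fun v => vo_color (out v)) x)
                  (arc_of port out) /\
                max_outdegree e (color_class (fun v => vo_color (out v)) x)
                  (arc_of port out) <= d
    & forall x i,
        max_degree e [set v in color_class (fun v => vo_color (out v)) x |
                       vo_part (out v) == i] <= d].
Proof.
move=> size_enc; split.
- by move=> i u v _ _; apply: size_enc.
- move=> c; split.
    move=> u v; rewrite !inE => /eqP cu /eqP cv uv.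
    by apply: arc_antisym => //; rewrite cu.
  apply/leq_max_outdegree => v _; have [x [tx _]] := outputE v.
  have [_ _ _ few_x _] := adoption tx; apply: leq_trans few_x.
  apply/subset_leq_card/subsetP => u; rewrite !inE => /and3P[_ vu].
  by rewrite vu (arc_ofE tx vu) => /andP[].
(* Neighbors of the same color and part adopted in the same round, so they are among the conflicts
   tolerated there. *)
- move=> c i; apply/leq_max_degree => v; rewrite !inE => /andP[/eqP cv /eqP pv].
  have [x [tx [_ part_v _]]] := outputE v.
  have [_ _ _ few_x _] := adoption tx; apply: leq_trans few_x.
  apply/subset_leq_card/subsetP => u; rewrite !inE => /andP[/andP[/eqP cu /eqP pu] vu].
  have [y [ty [_ part_u _]]] := outputE u.
  rewrite vu (conflict_of_same_color tx ty) ?cv ?cu //.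
  by rewrite -part_u -part_v pu pv.
Qed.

End Correctness.
End TrialAlgorithm.

(** * Assembling the theorem *)

(** For outputting the input coloring itself: no edge then lies inside a color class. *)
Lemma proper_coloring_correct (V : finType) (e a : rel V) (I C P : eqType)
    (input : V -> I) (color : V -> C) (part : V -> P) (d : nat) :
  proper_coloring e input -> (forall u v, color u = color v -> input u = input v) ->
  (forall x, orients e (color_class color x) a /\
             max_outdegree e (color_class color x) a <= d) /\
  (forall x i, max_degree e [set v in color_class color x | part v == i] <= d).
Proof.
move=> inputP color_input.
have no_edge x u v : color u == x -> color v == x -> e u v = false.
  move=> /eqP cu /eqP cv; apply/negP => /inputP.
  by rewrite (color_input u v) ?eqxx // cu.
split=> [x|x i].
  split=> [u v|]; first by rewrite !inE => cu cv; rewrite (no_edge x).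
  apply/leq_max_outdegree => v; rewrite inE => cv; rewrite eq_card0 // => u.
  by rewrite !inE; apply/and3P => -[cu]; rewrite (no_edge x).
apply/leq_max_degree => v; rewrite !inE => /andP[cv _]; rewrite eq_card0 // => u.
by rewrite !inE; apply/andP => -[/andP[cu _]]; rewrite (no_edge x).
Qed.

Theorem theorem1 (R : realType) :
  exists c : nat,
  forall m Delta d k : nat,
    d < Delta ->
    1 <= k ->
    (k%:R <= param_X R m Delta d)%R ->
  exists A : algorithm 'I_m
               (vertex_output (num_colors R m Delta d k)
                              (num_rounds R m Delta d k)),
  forall (V : finType) (e : rel V) (port : V -> seq V) (input : V -> 'I_m),
    simple_graph e ->
    max_degree e [set: V] <= Delta ->
    port_numbering e port ->
    proper_coloring e input ->
  let T := num_rounds R m Delta d k in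
  let out := result A port input T in
  let color := fun v => vo_color (out v) in
  let part := fun v => vo_part (out v) in
  let arc := arc_of port out in
  [/\ bandwidth_le A port input e T (c * up_log 2 (maxn #|V| m)),
      forall x, orients e (color_class color x) arc /\
                max_outdegree e (color_class color x) arc <= d
    & forall x i,
        max_degree e [set v in color_class color x | part v == i] <= d].
Proof.
exists 2 => m Delta d k lt_d k_gt0 le_kX.
have [s [f [s_gt0 lt_q lt_m]]] := field_size lt_d k_gt0 le_kX.
move: (num_colors R m Delta d k) (num_rounds R m Delta d k) => C P le_C le_P.
have q_gt0 : 0 < 2 ^ s by rewrite expn_gt0.
have C_gt0 : 0 < C by apply: leq_trans le_C; rewrite muln_gt0 k_gt0.
have P_gt0 : 0 < P by have := leq_trans q_gt0 le_P; rewrite muln_gt0 => /andP[].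
pose C0 := Ordinal C_gt0; pose P0 := Ordinal P_gt0.
(* [Delta] is not bounded in terms of [maxn #|V| m], so a trial may be too long
   for a message; but then the input coloring itself has few enough colors. *)
have [le_mC|lt_Cm] := leqP m C.
  pose A := Algorithm id (fun _ _ => [::]) (fun i _ => i)
    (fun i => VertexOutput (widen_ord le_mC i) P0 (fun=> false)).
  exists A => V e port input _ _ _ inputP T out color part arc.
  have runE t v : run A port input t v = input v by elim: t.
  have [] := @proper_coloring_correct V e arc _ _ _ input color part d inputP.
    move=> u v; rewrite /color /out /result !runE => /(congr1 val) /=.
    exact: val_inj.
  by split.
have lt_qm : 2 ^ s < m.
  by apply: leq_ltn_trans lt_Cm; apply: leq_trans le_C; rewrite leq_pmull.
have [h [few_coll few_pre]] := few_collisions s_gt0 lt_m.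
(* There are [2 ^ s + 1 <= m] values for the optional trial, so it costs no more bits than the input
   color; hence the constant 2. *)
have card_info : #|{: info m (2 ^ s)}| <= 2 ^ (2 * up_log 2 m).
  rewrite card_prod card_option !card_ord mulnC expnM -mulnn expnMn.
  by rewrite leq_mul ?up_logP // (leq_trans lt_qm) ?up_logP.
have [enc [dec [encK size_enc]]] := bit_encoding card_info.
exists (trial_algorithm k d h enc dec C0 P0).
move=> V e port input [e_sym _] e_deg portP inputP T out color part arc.
have := trial_algorithm_correct C0 P0 encK k_gt0 le_C le_P few_coll few_pre
  lt_q e_sym e_deg portP inputP.
apply => // w.
by rewrite size_enc leq_mul2l leq_up_log ?leq_maxr.
Qed.
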